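(* Let $d\ge2$ and let $\mathcal{H}_A,\mathcal{H}_B$ be $d$-dimensional complex Hilbert spaces. Let $\mathbb{P}_{A}=\{\mathcal{P}_{A}^{(1)},\ldots,\mathcal{P}_{A}^{(M)}\}$ be a set of $M$ mutually unbiased measurements of efficiency $\varkappa_{A}$ on $\mathcal{H}_{A}$, and let $\mathbb{Q}_{B}=\{\mathcal{Q}_{B}^{(1)},\ldots,\mathcal{Q}_{B}^{(M)}\}$ be a set of $M$ mutually unbiased measurements of efficiency $\varkappa_{B}$ on $\mathcal{H}_{B}$. If a density matrix $\tilde\rho_{AB}$ on $\mathcal{H}_A\otimes\mathcal{H}_B$ is separable, then the correlation measure $J_M$ satisfies $$J_{M}(\tilde\rho_{AB})\;\leq\;\frac{1}{d}\,\sqrt{M+\varkappa_{A}d-1}\,\sqrt{M+\varkappa_{B}d-1}.$$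
   Context: A density matrix is a positive semidefinite operator of trace one. A POVM with $d$ elements on a $d$-dimensional Hilbert space is a family of positive semidefinite operators $\{P_n\}_{n=1}^d$ with $\sum_n P_n=I$ (the identity). A set $\{\mathcal{P}^{(1)},\ldots,\mathcal{P}^{(M)}\}$ of POVMs $\mathcal{P}^{(b)}=\{P^{(b)}_n\}_{n=1}^d$, each with $d$ elements (an indexed family, $b=1,\dots,M$), on a $d$-dimensional Hilbert space is a set of $M$ mutually unbiased measurements (MUMs) of efficiency $\varkappa$ if: (i) $\mathrm{Tr}(P^{(b)}_n)=1$ for all $b,n$; (ii) $\mathrm{Tr}(P^{(a)}_mP^{(b)}_n)=\frac1d$ for all $a\neq b$ and all $m,n$; (iii) for all $b,m,n$, $\mathrm{Tr}(P^{(b)}_mP^{(b)}_n)=\delta_{mn}\,\varkappa+(1-\delta_{mn})\frac{1-\varkappa}{d-1}$. Here $\varkappa$ is a real parameter, for which $1/d\le\varkappa\le 1$. Write $\mathcal{P}_A^{(b)}=\{P_n^{(b)}\}_{n=1}^d$ and $\mathcal{Q}_B^{(b)}=\{Q_n^{(b)}\}_{n=1}^d$. For a density matrix $\tilde\rho_{AB}$ on $\mathcal{H}_A\otimes\mathcal{H}_B$, put $P^{(b)}(m,n)=\mathrm{Tr}\bigl((P_m^{(b)}\otimes Q_n^{(b)})\tilde\rho_{AB}\bigr)$, and define the correlation measure $$J_M(\tilde\rho_{AB})=\sum_{b=1}^M\sum_{n=1}^d P^{(b)}(n,n).$$ A density matrix $\tilde\rho_{AB}$ on $\mathcal{H}_A\otimes\mathcal{H}_B$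 is separable if it is a convex combination of product states: $\tilde\rho_{AB}=\sum_k q_k\,\rho_A^{(k)}\otimes\rho_B^{(k)}$ for some probability distribution $\{q_k\}$ and density matrices $\rho_A^{(k)}$ on $\mathcal{H}_A$, $\rho_B^{(k)}$ on $\mathcal{H}_B$. *)

(* Defs.v *)
(* Operators on a d-dimensional complex Hilbert space are d x d matrices over
   R[i], with R : realType, relative to an orthonormal basis; operators on the
   tensor product of two such spaces are indexed by the product basis, and
   A *t B is the Kronecker product. *)
From HB Require Import structures.
From mathcomp Require Export all_boot all_order all_algebra.
From mathcomp Require Export reals.
From mathcomp Require Export complex mxtens.

Set Implicit Arguments.
Unset Strict Implicit.
Unset Printing Implicit Defensive.

Import Order.TTheory GRing.Theory Num.Theory.

Local Open Scope ring_scope.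
Local Open Scope sesquilinear_scope.
Local Open Scope complex_scope.

(* The order on R[i] is partial: 0 <= z means that z is real and nonnegative. *)
Definition psdmx (R : realType) (n : nat) (A : 'M[R[i]]_n) : Prop :=
  A \is hermsymmx /\
  forall v : 'cV[R[i]]_n, 0 <= (v ^t* *m A *m v) 0 0.

Definition density_matrix (R : realType) (n : nat) (rho : 'M[R[i]]_n) : Prop :=
  psdmx rho /\ \tr rho = 1.

Definition povm (R : realType) (d : nat) (P : 'I_d -> 'M[R[i]]_d) : Prop :=
  (forall n, psdmx (P n)) /\ \sum_n P n = 1%:M.

Record mum (R : realType) (M d : nat) (kappa : R)
    (P : 'I_M -> 'I_d -> 'M[R[i]]_d) : Prop := {
  mum_efficiency : d%:R^-1 <= kappa <= 1;
  mum_povm : forall b, povm (P b);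
  mum_trace : forall b n, \tr (P b n) = 1;
  mum_unbiased : forall a b, a != b ->
    forall m n, \tr (P a m *m P b n) = d%:R^-1;
  mum_overlap : forall b m n, \tr (P b m *m P b n) =
    ((m == n)%:R * kappa
     + (1 - (m == n)%:R) * ((1 - kappa) / (d%:R - 1)))%:C
}.

Definition separable (R : realType) (dA dB : nat)
    (rho : 'M[R[i]]_(dA * dB)) : Prop :=
  exists (K : nat) (q : 'I_K -> R)
         (rhoA : 'I_K -> 'M[R[i]]_dA) (rhoB : 'I_K -> 'M[R[i]]_dB),
    [/\ (forall k, 0 <= q k) /\ \sum_k q k = 1,
        forall k, density_matrix (rhoA k),
        forall k, density_matrix (rhoB k)
      & rho = \sum_k (q k)%:C *: (rhoA k *t rhoB k)].

(* Born probabilities, kept in R[i] as traces: no real part is taken, so a bound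
   z <= x%:C on such a quantity z also asserts that z is real. *)
Definition joint_prob (R : realType) (M d : nat)
    (P Q : 'I_M -> 'I_d -> 'M[R[i]]_d) (rho : 'M[R[i]]_(d * d))
    (b : 'I_M) (m n : 'I_d) : R[i] :=
  \tr ((P b m *t Q b n) *m rho).

Definition correlation_measure (R : realType) (M d : nat)
    (P Q : 'I_M -> 'I_d -> 'M[R[i]]_d) (rho : 'M[R[i]]_(d * d)) : R[i] :=
  \sum_b \sum_n joint_prob P Q rho b n n.

(* Main.v *)
(** On a product state the coincidence probabilities are products
    p_b,n * p'_b,n of local ones, so by Cauchy-Schwarz and convexity it suffices
    that \sum_b,n p_b,n ^ 2 <= (M + kappa d - 1) / d for a single state sigma.
    Put c_b,n = p_b,n - 1/d, X = \sum c_b,n P_b,n and S = \sum c_b,n ^ 2.  As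
    \sum_n c_b,n = 0, the MUM relations give tr X = 0, tr (sigma X) = S and
    tr X^2 = S (kappa d - 1) / (d - 1).  Cauchy-Schwarz for the trace inner
    product of sigma - 1/d and X, together with tr sigma^2 <= 1, then yields
    S <= (kappa d - 1) / d. *)
Require Import Defs.
From mathcomp Require Import ring lra.

Set Implicit Arguments.
Unset Strict Implicit.
Unset Printing Implicit Defensive.

Import Order.TTheory GRing.Theory Num.Theory.

Local Open Scope ring_scope.
Local Open Scope complex_scope.

(** * Discriminants and the real Cauchy-Schwarz inequality *)

Lemma quadratic_ge0_discr (F : rcfType) (a b c : F) :
  (forall t, 0 <= a * t ^+ 2 + 2 * b * t + c) -> b ^+ 2 <= a * c.
Proof.
(* [Poly] drops leading zeros, so the degenerate case [a = 0] is covered. *)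
set p := Poly [:: c; 2 * b; a] => h.
have p_ge0 x : 0 <= p.[x].
  by rewrite horner_Poly /= mul0r add0r; have := h x; congr (_ <= _); ring.
have size_p : (size p <= 3)%N := size_Poly _.
have := deg_le2_poly_ge0 size_p p_ge0.
by rewrite !coef_Poly /=; nra.
Qed.

Lemma sum_mul_le_sqrt (F : rcfType) (I : finType) (x y : I -> F) :
  \sum_i x i * y i <=
    Num.sqrt (\sum_i x i ^+ 2) * Num.sqrt (\sum_i y i ^+ 2).
Proof.
have sq_ge0 (z : I -> F) : 0 <= \sum_i z i ^+ 2.
  by apply: sumr_ge0 => i _; apply: sqr_ge0.
rewrite -sqrtrM //; apply: le_trans (ler_norm _) _.
rewrite -sqrtr_sqr ler_wsqrtr //; apply: quadratic_ge0_discr => t.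
suff <- : \sum_i (x i * t + y i) ^+ 2 =
  (\sum_i x i ^+ 2) * t ^+ 2 + 2 * (\sum_i x i * y i) * t + \sum_i y i ^+ 2 by [].
rewrite mulr_sumr !mulr_suml -!big_split /=.
by apply: eq_bigr => i _; ring.
Qed.

(** * Trace inequalities for Hermitian and positive semidefinite matrices *)

Section Hermitian.
Variable R : realType.
Local Open Scope sesquilinear_scope.

Lemma hermsymmxP n (A : 'M[R[i]]_n) : A \is hermsymmx <-> A^t* = A.
Proof.
by split=> [/is_hermitianmxP|h]; [|apply/is_hermitianmxP];
  rewrite expr0 scale1r => //.
Qed.

Lemma conj_entry_herm n (A : 'M[R[i]]_n) i j :
  A \is hermsymmx -> Num.conj (A i j) = A j i.
Proof. by move=> /hermsymmxP {2}<-; rewrite !mxE. Qed.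

Lemma conj_real_complex (a : R) : Num.conj a%:C = a%:C.
Proof. exact: conjc_real. Qed.

Lemma hermsymmx_scalar n (a : R) : (a%:C%:M : 'M[R[i]]_n) \is hermsymmx.
Proof.
by apply/hermsymmxP; rewrite tr_scalar_mx map_scalar_mx /= conj_real_complex.
Qed.

Lemma hermsymmxB n (A B : 'M[R[i]]_n) :
  A \is hermsymmx -> B \is hermsymmx -> A - B \is hermsymmx.
Proof.
move=> /hermsymmxP hA /hermsymmxP hB; apply/hermsymmxP.
by rewrite linearB map_mxB hA hB.
Qed.

Lemma hermsymmxD n (A B : 'M[R[i]]_n) :
  A \is hermsymmx -> B \is hermsymmx -> A + B \is hermsymmx.
Proof.
move=> /hermsymmxP hA /hermsymmxP hB; apply/hermsymmxP.
by rewrite linearD map_mxD hA hB.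
Qed.

Lemma hermsymmxZ n (a : R) (A : 'M[R[i]]_n) :
  A \is hermsymmx -> a%:C *: A \is hermsymmx.
Proof.
move=> /hermsymmxP hA; apply/hermsymmxP.
by rewrite linearZ map_mxZ hA /= conj_real_complex.
Qed.

Lemma hermsymmx_sum n (I : finType) (A : I -> 'M[R[i]]_n) :
  (forall i, A i \is hermsymmx) -> \sum_i A i \is hermsymmx.
Proof.
move=> hA; apply: (big_ind (fun B => B \is hermsymmx)) => // [|B C].
  by have := hermsymmx_scalar n 0; rewrite raddf0.
exact: hermsymmxD.
Qed.

Lemma trace_mul_herm_real n (A B : 'M[R[i]]_n) :
  A \is hermsymmx -> B \is hermsymmx ->
  \tr (A *m B) = (complex.Re (\tr (A *m B)))%:C.
Proof.
move=> /hermsymmxP hA /hermsymmxP hB; symmetry; apply: RRe_real.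
apply/CrealP; rewrite -trace_map_mx -mxtrace_tr map_trmx trmx_mul map_mxM.
by rewrite hA hB mxtrace_mulC.
Qed.

Lemma trace_sqr_herm_ge0 n (A : 'M[R[i]]_n) :
  A \is hermsymmx -> 0 <= \tr (A *m A).
Proof.
move=> hA; apply: sumr_ge0 => i _; rewrite mxE; apply: sumr_ge0 => j _.
by rewrite -(conj_entry_herm i j hA) mul_conjC_ge0.
Qed.

(** For real t, t A + B is Hermitian, so tr (t A + B)^2 is a nonnegative real quadratic in t; its
    discriminant gives the bound. *)
Lemma trace_herm_CauchySchwarz n (A B : 'M[R[i]]_n) (a b c : R) :
  A \is hermsymmx -> B \is hermsymmx ->
  \tr (A *m A) = a%:C -> \tr (A *m B) = b%:C -> \tr (B *m B) = c%:C ->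
  b ^+ 2 <= a * c.
Proof.
move=> hA hB ha hb hc; apply: quadratic_ge0_discr => t.
have := trace_sqr_herm_ge0 (hermsymmxD (hermsymmxZ t hA) hB).
rewrite mulmxDl !mulmxDr !mxtraceD -!scalemxAl -!scalemxAr !mxtraceZ.
rewrite (mxtrace_mulC B A) ha hb hc -!(rmorphM, rmorphD) ler0c.
by congr (_ <= _); rewrite /=; ring.
Qed.

Lemma psdmx_minor2 n (A : 'M[R[i]]_n) i j :
  psdmx A -> A i j * A j i <= A i i * A j j.
Proof.
move=> [hA posA].
have form x y : let v := x *: delta_mx i 0 + y *: delta_mx j 0 : 'cV_n in
  (v^t* *m A *m v) 0 0 =
  Num.conj x * x * A i i + Num.conj x * y * A i j
  + Num.conj y * x * A j i + Num.conj y * y * A j j.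
  have entry k l : delta_mx 0 k *m A *m delta_mx l 0 = (A k l)%:M :> 'M_1.
    by rewrite -rowE -colE [LHS]mx11_scalar !mxE.
  move=> /=; have -> : (x *: delta_mx i 0 + y *: delta_mx j 0 : 'cV_n)^t* =
      Num.conj x *: delta_mx 0 i + Num.conj y *: delta_mx 0 j.
    by rewrite linearD !linearZ /= !trmx_delta map_mxD !map_mxZ !map_delta_mx.
  rewrite !mulmxDl -!scalemxAl !mulmxDr -!scalemxAr -?scalemxAl !entry !mxE /=.
  by ring.
have diag k : exists2 a : R, 0 <= a & A k k = a%:C.
  have kk : 0 <= A k k.
    have := posA (delta_mx k 0).
    by rewrite trmx_delta map_delta_mx -rowE -colE !mxE.
  have /complex_realP[a ha] := ger0_real kk.
  by exists a; rewrite // -ler0c -ha.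
have [a a0 ha] := diag i; have [c c0 hc] := diag j.
have [N hN] : exists N : R, A i j * A j i = N%:C.
  apply/complex_realP.
  by rewrite -(conj_entry_herm i j hA) ger0_real ?mul_conjC_ge0.
have N0 : 0 <= N by rewrite -ler0c -hN -(conj_entry_herm i j hA) mul_conjC_ge0.
rewrite hN ha hc -rmorphM lecR.
(* Positivity on the vectors t A_ij e_i + e_j, t real. *)
have : N ^+ 2 <= (N * a) * c.
  apply: quadratic_ge0_discr => t.
  have := posA ((t%:C * A i j) *: delta_mx i 0 + 1 *: delta_mx j 0).
  rewrite form rmorphM rmorph1 /= (conj_entry_herm i j hA) conj_real_complex.
  rewrite ha hc -ler0c !(rmorphM, rmorphD) /= -hN.
  by congr (_ <= _); rewrite /=; ring.
(* Here N = |A_ij|^2. If it is nonzero, one factor N cancels from N^2 <= N a c. *)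
have [->|N_neq0] := eqVneq N 0; first by rewrite mulr_ge0.
by rewrite -mulrA expr2 ler_pM2l // lt_def N_neq0.
Qed.
(** Summing the 2 x 2 minor inequality over all i, j gives the bound without diagonalizing A. For a
    state it says that the purity is at most 1. *)
Lemma trace_sqr_psdmx_le n (A : 'M[R[i]]_n) :
  psdmx A -> \tr (A *m A) <= \tr A ^+ 2.
Proof.
move=> psdA; rewrite expr2 /mxtrace mulr_suml; apply: ler_sum => i _.
by rewrite mxE mulr_sumr; apply: ler_sum => j _; apply: psdmx_minor2.
Qed.

End Hermitian.

Lemma mxtrace_tens (R : comPzRingType) (m n : nat) (A : 'M[R]_m) (B : 'M[R]_n) :
  \tr (A *t B) = \tr A * \tr B.
Proof.
rewrite /mxtrace mulr_sum.
apply: eq_bigr => k _; case: (mxtens_indexP k) => i j.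
by rewrite tensmxE !mxtens_indexK.
Qed.

Lemma mum_prob_real (R : realType) (d M : nat) (kappa : R)
    (P : 'I_M -> 'I_d -> 'M[R[i]]_d) (sigma : 'M[R[i]]_d) :
  mum kappa P -> density_matrix sigma -> forall b n,
  \tr (P b n *m sigma) = (complex.Re (\tr (P b n *m sigma)))%:C.
Proof.
move=> hP [[herm_sigma _] _] b n; apply: trace_mul_herm_real herm_sigma.
by case: (mum_povm hP b) => /(_ n)[].
Qed.

Lemma mum_index_of_coincidence_le (R : realType) (d M : nat) (kappa : R)
    (P : 'I_M -> 'I_d -> 'M[R[i]]_d) (sigma : 'M[R[i]]_d)
    (p : 'I_M -> 'I_d -> R) :
  (2 <= d)%N -> mum kappa P -> density_matrix sigma ->
  (forall b n, \tr (P b n *m sigma) = (p b n)%:C) ->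
  \sum_b \sum_n p b n ^+ 2 <= d%:R^-1 * (M%:R + kappa * d%:R - 1).
Proof.
move=> d_ge2 [kappa_bnd povmP trP unbP overP] [psd_sigma tr_sigma] pE.
have d_gt1 : 1 < d%:R :> R by rewrite ltr1n.
have d_neq0 : d%:R != 0 :> R by rewrite gt_eqF // (lt_trans ltr01).
have d1_neq0 : d%:R - 1 != 0 :> R by rewrite subr_eq0 gt_eqF.
have herm_sigma : sigma \is hermsymmx by case: psd_sigma.
have hermP b n : P b n \is hermsymmx by case: (povmP b) => /(_ n)[].
have sum_p b : \sum_n p b n = 1.
  apply: complexI; rewrite rmorph_sum rmorph1 -tr_sigma -[sigma]mul1mx.
  have [_ <-] := povmP b; rewrite mulmx_suml raddf_sum.
  by apply: eq_bigr => n _ /=; rewrite pE.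
pose c b n := p b n - d%:R^-1.
have sum_c b : \sum_n c b n = 0.
  by rewrite sumrB sum_p sumr_const card_ord -[_ *+ d]mulr_natr mulVf // subrr.
pose S := \sum_b \sum_n c b n ^+ 2.
have pS : \sum_b \sum_n p b n ^+ 2 = S + d%:R^-1 * M%:R.
  have -> : d%:R^-1 * M%:R = \sum_(b < M) d%:R^-1 :> R.
    by rewrite sumr_const card_ord mulr_natr.
  rewrite -big_split; apply: eq_bigr => b _ /=.
  (* Expansion around the mean 1/d: the cross term sums to 0, and the d constants 1/d^2 add up to
     1/d for each b. *)
  transitivity (\sum_n (c b n ^+ 2 + (2 * d%:R^-1 * c b n + d%:R^-1 ^+ 2))).
    by apply: eq_bigr => n _; rewrite /c; field.
  rewrite !big_split /= -mulr_sumr sum_c mulr0 add0r sumr_const card_ord.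
  by rewrite -mulr_natr; congr (_ + _); field.
(* [alpha] is kappa - (1 - kappa) / (d - 1), the gap between the diagonal and off-diagonal overlaps
   within one measurement. *)
pose alpha := (kappa * d%:R - 1) / (d%:R - 1).
pose X := \sum_b \sum_n (c b n)%:C *: P b n.
have trX (Y : 'M_d) : \tr (Y *m X) = \sum_b \sum_n (c b n)%:C * \tr (Y *m P b n).
  rewrite mulmx_sumr raddf_sum; apply: eq_bigr => b _.
  rewrite mulmx_sumr raddf_sum; apply: eq_bigr => n _ /=.
  by rewrite -scalemxAr mxtraceZ.
have hermX : X \is hermsymmx.
  by apply: hermsymmx_sum => b; apply: hermsymmx_sum => n; apply: hermsymmxZ.
(* Each b other than a contributes 1/d times \sum_n c_b,n, which is 0. Within a, the common overlap
   [eta] is split off every term and vanishes in the same way, leaving [alpha] at n = m. *)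
have tr_PX a m : \tr (P a m *m X) = (alpha * c a m)%:C.
  rewrite trX (bigD1 a) //= [X in _ + X]big1 => [|b b_neq_a]; last first.
    under eq_bigr => n _ do rewrite unbP 1?eq_sym //.
    by rewrite -mulr_suml -rmorph_sum /= sum_c rmorph0 mul0r.
  under eq_bigr => n _ do rewrite overP -rmorphM.
  rewrite addr0 -rmorph_sum; congr (_%:C).
  pose eta := (1 - kappa) / (d%:R - 1).
  transitivity (\sum_n ((if n == m then alpha * c a n else 0) + c a n * eta)).
    apply: eq_bigr => n _; rewrite /alpha /eta eq_sym.
    by case: eqP => _ /=; field.
  by rewrite big_split /= -mulr_suml sum_c mul0r addr0 -big_mkcond big_pred1_eq.
have tr_X : \tr X = 0.
  rewrite -[X]mul1mx trX big1 // => b _.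
  under eq_bigr => n _ do rewrite mul1mx trP mulr1.
  by rewrite -rmorph_sum /= sum_c.
have tr_XX : \tr (X *m X) = (alpha * S)%:C.
  rewrite trX mulr_sumr rmorph_sum; apply: eq_bigr => b _.
  rewrite mulr_sumr rmorph_sum; apply: eq_bigr => n _ /=.
  by rewrite mxtrace_mulC tr_PX -rmorphM; congr (_%:C); ring.
have tr_sX : \tr (sigma *m X) = S%:C.
  rewrite trX rmorph_sum; apply: eq_bigr => b _.
  (* Since p = c + 1/d, each term c p equals c^2 + c/d, and the linear part sums to 0. *)
  transitivity ((\sum_n (c b n ^+ 2 + d%:R^-1 * c b n))%:C).
    rewrite rmorph_sum; apply: eq_bigr => n _ /=.
    by rewrite mxtrace_mulC pE -rmorphM; congr (_%:C); rewrite /c; ring.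
  by rewrite big_split /= -mulr_sumr sum_c mulr0 addr0.
(* As tr X = 0, removing the maximally mixed part of sigma keeps the pairing with X but lowers the
   squared norm by 1/d. *)
pose Y := sigma - (d%:R^-1)%:C%:M.
have hermY : Y \is hermsymmx by rewrite hermsymmxB // hermsymmx_scalar.
have tr_YX : \tr (Y *m X) = S%:C.
  by rewrite mulmxBl mul_scalar_mx raddfB /= mxtraceZ tr_X mulr0 subr0.
have [y yE] : exists y : R, \tr (Y *m Y) = y%:C.
  by exists (complex.Re (\tr (Y *m Y))); apply: trace_mul_herm_real.
have y_le : y <= 1 - d%:R^-1.
  rewrite -lecR -yE mulmxBl !mulmxBr mul_scalar_mx mul_mx_scalar.
  rewrite !raddfB /= !mxtraceZ mul_scalar_mx mxtraceZ mxtrace_scalar tr_sigma.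
  have := trace_sqr_psdmx_le psd_sigma; rewrite tr_sigma expr1n => le1.
  have -> : ((d%:R^-1 : R)%:C) *+ d = 1.
    by rewrite -rmorphMn -mulr_natl divff.
  by rewrite mulr1 subrr addr0 rmorph1 lerB.
have CS := trace_herm_CauchySchwarz hermY hermX yE tr_YX tr_XX.
have S_ge0 : 0 <= S.
  by apply: sumr_ge0 => b _; apply: sumr_ge0 => n _; apply: sqr_ge0.
have k_ge0 : 0 <= kappa * d%:R - 1.
  case/andP: kappa_bnd => h _.
  by rewrite subr_ge0 -ler_pdivrMr ?div1r // (lt_trans ltr01).
have alpha_ge0 : 0 <= alpha by rewrite divr_ge0 // subr_ge0 ltW.
have alphaE : (1 - d%:R^-1) * alpha = d%:R^-1 * (kappa * d%:R - 1).
  by rewrite /alpha; field; rewrite d_neq0.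
rewrite pS -addrA mulrDr [S + _]addrC lerD2l -alphaE.
(* Cauchy-Schwarz reads S^2 <= y alpha S. If S is nonzero it cancels; if S = 0, the bound is
   nonnegative because kappa >= 1/d. *)
have [->|S_neq0] := eqVneq S 0.
  by rewrite mulr_ge0 // subr_ge0 invf_le1 ?ltW // (lt_trans ltr01).
rewrite -(@ler_pM2r _ S) ?lt_def ?S_neq0 // -expr2 -mulrA (le_trans CS) //.
by rewrite ler_wpM2r // mulr_ge0.
Qed.

Theorem proposition6 (R : realType) (d M : nat) (hd : (2 <= d)%N)
  (kappaA kappaB : R) (P Q : 'I_M -> 'I_d -> 'M[R[i]]_d)
  (hP : mum kappaA P) (hQ : mum kappaB Q)
  (rho : 'M[R[i]]_(d * d)) (hrho : density_matrix rho) (hsep : separable rho) :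
  correlation_measure P Q rho <=
    (d%:R^-1 * Num.sqrt (M%:R + kappaA * d%:R - 1)
             * Num.sqrt (M%:R + kappaB * d%:R - 1))%:C.
Proof.
case: hsep => K [q [rhoA [rhoB [[q_ge0 sum_q] dA dB ->]]]].
pose p k b n := complex.Re (\tr (P b n *m rhoA k)).
pose p' k b n := complex.Re (\tr (Q b n *m rhoB k)).
set B := _ * _ * _.
have term k : \sum_b \sum_n p k b n * p' k b n <= B.
  (* Cauchy-Schwarz is applied once, over the pairs (b, n); the two resulting factors sqrt (1/d)
     later merge into 1/d. *)
  rewrite pair_bigA /=; apply: le_trans (sum_mul_le_sqrt _ _) _.
  rewrite -(pair_bigA _ (fun b n => p k b n ^+ 2)).
  rewrite -(pair_bigA _ (fun b n => p' k b n ^+ 2)) /=.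
  have bA := mum_index_of_coincidence_le hd hP (dA k) (mum_prob_real hP (dA k)).
  have bB := mum_index_of_coincidence_le hd hQ (dB k) (mum_prob_real hQ (dB k)).
  apply: le_trans (ler_pM (sqrtr_ge0 _) (sqrtr_ge0 _)
                          (ler_wsqrtr bA) (ler_wsqrtr bB)) _.
  have dV_ge0 : 0 <= d%:R^-1 :> R by rewrite invr_ge0.
  by rewrite !sqrtrM // mulrACA -expr2 sqr_sqrtr // mulrA.
(* By linearity the measure is the q-average of its values on the product states, where each trace
   factorizes. *)
have -> : correlation_measure P Q (\sum_k (q k)%:C *: (rhoA k *t rhoB k)) =
    (\sum_k q k * \sum_b \sum_n p k b n * p' k b n)%:C.
  under [in RHS]eq_bigr => k _ do rewrite mulr_sumr.
  rewrite [in RHS]exchange_big rmorph_sum; apply: eq_bigr => b _ /=.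
  under [in RHS]eq_bigr => k _ do rewrite mulr_sumr.
  rewrite [in RHS]exchange_big rmorph_sum; apply: eq_bigr => n _ /=.
  rewrite /joint_prob mulmx_sumr raddf_sum rmorph_sum; apply: eq_bigr => k _ /=.
  rewrite -scalemxAr mxtraceZ tensmx_mul mxtrace_tens.
  by rewrite (mum_prob_real hP (dA k)) (mum_prob_real hQ (dB k)) -!rmorphM.
(* Writing [B] as \sum_k q_k B reduces the average to the bound for each k. *)
rewrite lecR -[leRHS]mul1r -sum_q mulr_suml.
by apply: ler_sum => k _; apply: ler_wpM2l.
Qed.
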